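(* Every Garside monoid $\mathbf{M}$ admits the $(3,1)$-polygraph $\mathrm{Gar}_3(\mathbf{M})$ as a coherent presentation.
   Context: **Polygraphs and coherent presentations.** All $n$-categories are strict and globular; $f\star_i g$ is composition along $i$-cells in diagrammatic order. A $2$-polygraph consists of a set $\Sigma_0$ of $0$-cells, a set $\Sigma_1$ of generating $1$-cells with source and target in $\Sigma_0$ (generating the free category $\Sigma_1^*$), and a set $\Sigma_2$ of generating $2$-cells, each with source and target a pair of parallel $1$-cells of $\Sigma_1^*$. $\Sigma_2^\top$ denotes the free $(2,1)$-category it generates (all $2$-cells invertible for $\star_1$). The category presented is the quotient of $\Sigma_1^*$ by the congruence generated by $\Sigma_2$. A $(3,1)$-polygraph $\Sigma$ is a $2$-polygraph together with a set $\Sigma_3$ of generating $3$-cells, each with source and target a pair of parallel $2$-cells of $\Sigma_2^\top$; the category it presents is the one presented by its underlying $2$-polygraph, and the $(2,1)$-category it presents is $\overline{\Sigma}=\Sigma_2^\top/\Sigma_3$ (identify $s(\gamma)$ and $t(\gamma)$ for all $\gamma\in\Sigma_3$). $\Sigma$ is a coherent presentation of a category $\mathbf{C}$ if the category it presents is isomorphic to $\mathbf{C}$ and $\Sigma_3$ is a homotopy basis, i.e. any two parallel $2$-cells of $\Sigma_2^\top$ become equal in $\overline{\Sigma}$. A monoid is a category with one object. **Garside monoids.** A Garside monoid is a monoid $\mathbf{M}$ that is left and right cancellative, admits a map $\lambda:\mathbf{M}\to\mathbb{N}$ with $\lambda(fg)\ge\lambda(f)+\lambda(g)$ and $\lambda(f)\neq0$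 for $f\neq1$, in which any two elements have left and right gcds and lcms, and which has a (fixed) Garside element $w_0$: the left divisors and right divisors of $w_0$ coincide, form a finite set $\mathbf{W}$, and $\mathbf{W}$ generates $\mathbf{M}$. **Garside's presentation.** $uv$ denotes the product in $\mathbf{M}$ and $u|v$ the product in the free monoid over $\mathbf{W}\setminus\{1\}$. $\mathrm{Gar}_3(\mathbf{M})$ is the $(3,1)$-polygraph with one $0$-cell, the elements of $\mathbf{W}\setminus\{1\}$ as $1$-cells, one $2$-cell $\alpha_{u,v}:u|v\Rightarrow uv$ for all $u,v\in\mathbf{W}\setminus\{1\}$ such that $uv\in\mathbf{W}$ (equivalently, $v$ is a left divisor of the element $\partial(u)$ defined by $u\,\partial(u)=w_0$), and one $3$-cell $$A_{u,v,w}:\ (\alpha_{u,v}|w)\star_1\alpha_{uv,w}\ \Rrightarrow\ (u|\alpha_{v,w})\star_1\alpha_{u,vw}$$ for all $u,v,w\in\mathbf{W}\setminus\{1\}$ such that $uv$, $vw$ and $uvw$ are in $\mathbf{W}$. *)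

(* Defs.v *)
From HB Require Import structures.
From mathcomp Require Import all_boot generic_quotient.
From mathcomp Require Import boolp classical_sets cardinality.

Set Implicit Arguments.
Unset Strict Implicit.
Unset Printing Implicit Defensive.

Local Open Scope classical_set_scope.
Local Open Scope quotient_scope.

(* All compositions are written in diagrammatic order. *)

Record category := Category {
  obj : Type;
  hom : obj -> obj -> Type;
  idc : forall x, hom x x;
  comp : forall x y z, hom x y -> hom y z -> hom x z;
  compA : forall x y z t (f : hom x y) (g : hom y z) (h : hom z t),
    comp f (comp g h) = comp (comp f g) h;
  comp1c : forall x y (f : hom x y), comp (idc x) f = f;
  compc1 : forall x y (f : hom x y), comp f (idc y) = f }.

Arguments hom : clear implicits.
Arguments idc : clear implicits.

Record functor (C D : category) := Functor {
  fobj : obj C -> obj D;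
  fhom : forall x y, hom C x y -> hom D (fobj x) (fobj y);
  fhom_id : forall x, fhom (idc C x) = idc D (fobj x);
  fhom_comp : forall x y z (f : hom C x y) (g : hom C y z),
    fhom (comp f g) = comp (fhom f) (fhom g) }.

Definition isomorphic_categories (C D : category) : Prop :=
  exists F : functor C D,
    bijective (fobj F) /\ forall x y, bijective (@fhom C D F x y).

Definition monoid_category (M : monoidType) : category :=
  @Category unit (fun _ _ => M) (fun _ => 1%g) (fun _ _ _ f g => (f * g)%g)
    (fun _ _ _ _ => @mulgA M) (fun _ _ => @mul1g M) (fun _ _ => @mulg1 M).

Section QuotientType.
Variables (T : Type) (R : T -> T -> Prop).
Hypotheses (Rxx : forall x, R x x) (Rsym : forall x y, R x y -> R y x)
  (Rtrans : forall x y z, R x y -> R y z -> R x z).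

Let r (x y : {classic T}) : bool := `[< R x y >].

Let r_refl : reflexive r. Proof. by move=> x; apply/asboolP. Qed.

Let r_sym : symmetric r.
Proof. by move=> x y; apply/asboolP/asboolP; apply: Rsym. Qed.

Let r_trans : transitive r.
Proof.
by move=> y x z /asboolP Rxy /asboolP Ryz; apply/asboolP; apply: Rtrans Ryz.
Qed.

Definition prop_equiv_rel : equiv_rel {classic T} :=
  EquivRel r r_refl r_sym r_trans.

(* The set of equivalence classes of R; [cls] and [rep] are the canonical
   surjection and a choice of representatives. *)
Definition classes : Type := {eq_quot prop_equiv_rel}.

Definition cls (x : T) : classes := \pi_({eq_quot prop_equiv_rel}) x.

Definition rep (c : classes) : T := repr (c : {eq_quot prop_equiv_rel}).

Lemma repK c : cls (rep c) = c. Proof. by rewrite /cls /rep reprK. Qed.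

Lemma clsP x y : cls x = cls y <-> R x y.
Proof.
split=> [/eqmodP /asboolP //|Rxy]; apply/eqmodP; exact/asboolP.
Qed.

Lemma rep_cls x : R (rep (cls x)) x.
Proof. by apply/clsP; rewrite repK. Qed.

End QuotientType.

Section QuotientCategory.
Variables (C : category) (R : forall x y, hom C x y -> hom C x y -> Prop).

Inductive congruence_closure :
    forall x y, hom C x y -> hom C x y -> Prop :=
| cc_base x y (f g : hom C x y) : R f g -> congruence_closure f g
| cc_refl x y (f : hom C x y) : congruence_closure f f
| cc_sym x y (f g : hom C x y) :
    congruence_closure f g -> congruence_closure g f
| cc_trans x y (f g h : hom C x y) :
    congruence_closure f g -> congruence_closure g h -> congruence_closure f h
| cc_comp x y z (f f' : hom C x y) (g g' : hom C y z) :
    congruence_closure f f' -> congruence_closure g g' ->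
    congruence_closure (comp f g) (comp f' g').

Definition quotient_hom (x y : obj C) : Type :=
  classes (@cc_refl x y) (@cc_sym x y) (@cc_trans x y).

Definition quotient_cls (x y : obj C) (f : hom C x y) : quotient_hom x y :=
  cls (@cc_refl x y) (@cc_sym x y) (@cc_trans x y) f.

Definition quotient_comp x y z (f : quotient_hom x y) (g : quotient_hom y z) :
    quotient_hom x z :=
  quotient_cls (comp (rep f) (rep g)).

Lemma quotient_comp_cls x y z (f : hom C x y) (g : hom C y z) :
  quotient_comp (quotient_cls f) (quotient_cls g) = quotient_cls (comp f g).
Proof. by apply/clsP; apply: cc_comp; apply: rep_cls. Qed.

Lemma quotient_repK x y (f : quotient_hom x y) : quotient_cls (rep f) = f.
Proof. exact: repK. Qed.

Lemma quotient_compA x y z t (f : quotient_hom x y) (g : quotient_hom y z)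
    (h : quotient_hom z t) :
  quotient_comp f (quotient_comp g h) = quotient_comp (quotient_comp f g) h.
Proof.
by rewrite -(quotient_repK f) -(quotient_repK g) -(quotient_repK h) !quotient_comp_cls compA.
Qed.

Lemma quotient_comp1c x y (f : quotient_hom x y) :
  quotient_comp (quotient_cls (idc C x)) f = f.
Proof. by rewrite -(quotient_repK f) quotient_comp_cls comp1c. Qed.

Lemma quotient_compc1 x y (f : quotient_hom x y) :
  quotient_comp f (quotient_cls (idc C y)) = f.
Proof. by rewrite -(quotient_repK f) quotient_comp_cls compc1. Qed.

Definition quotient_category : category :=
  Category quotient_compA quotient_comp1c quotient_compc1.

End QuotientCategory.

Record polygraph1 := Polygraph1 {
  cell0 : Type;
  gen1 : Type;
  src1 : gen1 -> cell0;
  tgt1 : gen1 -> cell0 }.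

Inductive path1 (P : polygraph1) : cell0 P -> cell0 P -> Type :=
| path_id x : path1 x x
| path_cons (a : gen1 P) y : path1 (tgt1 a) y -> path1 (src1 a) y.

Arguments path_id {P} x.
Arguments path_cons {P} a {y} p.

Fixpoint path_cat (P : polygraph1) (x y z : cell0 P) (p : path1 x y) :
    path1 y z -> path1 x z :=
  match p in path1 x y return path1 y z -> path1 x z with
  | path_id _ => fun q => q
  | path_cons a _ p' => fun q => path_cons a (path_cat p' q)
  end.

Lemma path_catA (P : polygraph1) (x y z t : cell0 P)
    (p : path1 x y) (q : path1 y z) (r : path1 z t) :
  path_cat p (path_cat q r) = path_cat (path_cat p q) r.
Proof.
move: z t q r; elim: p => [//|a y' p IHp] z t q r.
by rewrite /= IHp.
Qed.

Lemma path_cat1p (P : polygraph1) (x y : cell0 P) (p : path1 x y) :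
  path_cat (path_id x) p = p.
Proof. by []. Qed.

Lemma path_catp1 (P : polygraph1) (x y : cell0 P) (p : path1 x y) :
  path_cat p (path_id y) = p.
Proof. by elim: p => [//|a y' p IHp] /=; rewrite IHp. Qed.

Definition free_category (P : polygraph1) : category :=
  Category (@path_catA P) (@path_cat1p P) (@path_catp1 P).

(* Parallelism of the source and target is enforced by the types. *)
Record polygraph2 := Polygraph2 {
  poly1 :> polygraph1;
  gen2 : Type;
  dom2 : gen2 -> cell0 poly1;
  cod2 : gen2 -> cell0 poly1;
  src2 : forall a, path1 (dom2 a) (cod2 a);
  tgt2 : forall a, path1 (dom2 a) (cod2 a) }.

Inductive gen2_rel (P : polygraph2) :
    forall x y : cell0 P, path1 x y -> path1 x y -> Prop :=
| Gen2Rel (a : gen2 P) : gen2_rel (src2 a) (tgt2 a).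

Definition presented_category (P : polygraph2) : category :=
  @quotient_category (free_category P) (@gen2_rel P).

Section FreeTwoOneCategory.
Variable P : polygraph2.

Inductive term2 : forall x y : cell0 P, path1 x y -> path1 x y -> Type :=
| tgen (a : gen2 P) : term2 (src2 a) (tgt2 a)
| tid x y (p : path1 x y) : term2 p p
| tvcomp x y (p q r : path1 x y) : term2 p q -> term2 q r -> term2 p r
| tinv x y (p q : path1 x y) : term2 p q -> term2 q p
| thcomp x y z (p q : path1 x y) (p' q' : path1 y z) :
    term2 p q -> term2 p' q' -> term2 (path_cat p p') (path_cat q q').

(* The congruence imposing the axioms of (2,1)-categories. It relates terms
   whose boundaries are a priori different, because in strict associativity
   and unitality of the horizontal composition both sides have boundaries
   that are equal but not convertible; related terms always have equal
   boundaries. *)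
Inductive eqt : forall (x y : cell0 P) (p q p' q' : path1 x y),
    term2 p q -> term2 p' q' -> Prop :=
| eqt_refl x y (p q : path1 x y) (f : term2 p q) : eqt f f
| eqt_sym x y (p q p' q' : path1 x y) (f : term2 p q) (f' : term2 p' q') :
    eqt f f' -> eqt f' f
| eqt_trans x y (p q p' q' p'' q'' : path1 x y) (f : term2 p q)
    (f' : term2 p' q') (f'' : term2 p'' q'') :
    eqt f f' -> eqt f' f'' -> eqt f f''
| eqt_vcomp x y (p q r p' q' r' : path1 x y) (f : term2 p q) (g : term2 q r)
    (f' : term2 p' q') (g' : term2 q' r') :
    eqt f f' -> eqt g g' -> eqt (tvcomp f g) (tvcomp f' g')
| eqt_inv x y (p q p' q' : path1 x y) (f : term2 p q) (f' : term2 p' q') :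
    eqt f f' -> eqt (tinv f) (tinv f')
| eqt_hcomp x y z (p q p' q' : path1 x y) (r s r' s' : path1 y z)
    (f : term2 p q) (f' : term2 p' q') (g : term2 r s) (g' : term2 r' s') :
    eqt f f' -> eqt g g' -> eqt (thcomp f g) (thcomp f' g')
| eqt_vcompA x y (p q r s : path1 x y) (f : term2 p q) (g : term2 q r)
    (h : term2 r s) :
    eqt (tvcomp f (tvcomp g h)) (tvcomp (tvcomp f g) h)
| eqt_vcomp1f x y (p q : path1 x y) (f : term2 p q) :
    eqt (tvcomp (tid p) f) f
| eqt_vcompf1 x y (p q : path1 x y) (f : term2 p q) :
    eqt (tvcomp f (tid q)) f
| eqt_vcompfV x y (p q : path1 x y) (f : term2 p q) :
    eqt (tvcomp f (tinv f)) (tid p)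
| eqt_vcompVf x y (p q : path1 x y) (f : term2 p q) :
    eqt (tvcomp (tinv f) f) (tid q)
| eqt_hcompA x y z t (p q : path1 x y) (p' q' : path1 y z)
    (p'' q'' : path1 z t) (f : term2 p q) (g : term2 p' q')
    (h : term2 p'' q'') :
    eqt (thcomp f (thcomp g h)) (thcomp (thcomp f g) h)
| eqt_hcomp1f x y (p q : path1 x y) (f : term2 p q) :
    eqt (thcomp (tid (path_id x)) f) f
| eqt_hcompf1 x y (p q : path1 x y) (f : term2 p q) :
    eqt (thcomp f (tid (path_id y))) f
| eqt_hcomp_id x y z (p : path1 x y) (q : path1 y z) :
    eqt (thcomp (tid p) (tid q)) (tid (path_cat p q))
| eqt_exchange x y z (p q r : path1 x y) (p' q' r' : path1 y z)
    (f : term2 p q) (g : term2 q r) (f' : term2 p' q') (g' : term2 q' r') :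
    eqt (thcomp (tvcomp f g) (tvcomp f' g'))
        (tvcomp (thcomp f f') (thcomp g g')).

Lemma eqt_boundary (x y : cell0 P) (p q p' q' : path1 x y)
    (f : term2 p q) (f' : term2 p' q') : eqt f f' -> p = p' /\ q = q'.
Proof.
by elim=> {x y p q p' q' f f'} *;
  repeat match goal with H : _ /\ _ |- _ => case: H => ? ? end; subst;
  rewrite ?path_catA ?path_catp1.
Qed.

(* The 2-cells p => q of the free (2,1)-category. *)
Definition cell2 (x y : cell0 P) (p q : path1 x y) : Type :=
  classes (@eqt_refl x y p q) (@eqt_sym x y p q p q)
    (@eqt_trans x y p q p q p q).

Definition term_cell (x y : cell0 P) (p q : path1 x y) (f : term2 p q) :
    cell2 p q :=
  cls (@eqt_refl x y p q) (@eqt_sym x y p q p q)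
    (@eqt_trans x y p q p q p q) f.

Definition gen_cell (a : gen2 P) : cell2 (src2 a) (tgt2 a) :=
  term_cell (tgen a).

Definition id_cell (x y : cell0 P) (p : path1 x y) : cell2 p p :=
  term_cell (tid p).

Definition vcomp (x y : cell0 P) (p q r : path1 x y)
    (f : cell2 p q) (g : cell2 q r) : cell2 p r :=
  term_cell (tvcomp (rep f) (rep g)).

Definition inv_cell (x y : cell0 P) (p q : path1 x y) (f : cell2 p q) :
    cell2 q p :=
  term_cell (tinv (rep f)).

Definition hcomp (x y z : cell0 P) (p q : path1 x y) (p' q' : path1 y z)
    (f : cell2 p q) (g : cell2 p' q') :
    cell2 (path_cat p p') (path_cat q q') :=
  term_cell (thcomp (rep f) (rep g)).

Lemma term_cell_vcomp (x y : cell0 P) (p q r : path1 x y) (f : term2 p q)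
    (g : term2 q r) :
  vcomp (term_cell f) (term_cell g) = term_cell (tvcomp f g).
Proof. by apply/clsP; apply: eqt_vcomp; apply: rep_cls. Qed.

Lemma term_cell_inv (x y : cell0 P) (p q : path1 x y) (f : term2 p q) :
  inv_cell (term_cell f) = term_cell (tinv f).
Proof. by apply/clsP; apply: eqt_inv; apply: rep_cls. Qed.

Lemma term_cell_hcomp (x y z : cell0 P) (p q : path1 x y) (p' q' : path1 y z)
    (f : term2 p q) (g : term2 p' q') :
  hcomp (term_cell f) (term_cell g) = term_cell (thcomp f g).
Proof. by apply/clsP; apply: eqt_hcomp; apply: rep_cls. Qed.

Definition whisker_r (x y z : cell0 P) (p q : path1 x y) (f : cell2 p q)
    (r : path1 y z) : cell2 (path_cat p r) (path_cat q r) :=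
  hcomp f (id_cell r).

Definition whisker_l (x y z : cell0 P) (r : path1 x y) (p q : path1 y z)
    (f : cell2 p q) : cell2 (path_cat r p) (path_cat r q) :=
  hcomp (id_cell r) f.

Definition cast_tgt (x y : cell0 P) (p q q' : path1 x y) (e : q = q')
    (f : cell2 p q) : cell2 p q' :=
  let: erefl := e in f.

End FreeTwoOneCategory.

Record polygraph31 := Polygraph31 {
  poly2 :> polygraph2;
  gen3 : Type;
  dom3 : gen3 -> cell0 poly2;
  cod3 : gen3 -> cell0 poly2;
  pdom3 : forall A, path1 (dom3 A) (cod3 A);
  pcod3 : forall A, path1 (dom3 A) (cod3 A);
  src3 : forall A, cell2 (pdom3 A) (pcod3 A);
  tgt3 : forall A, cell2 (pdom3 A) (pcod3 A) }.

Section PresentedTwoOneCategory.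
Variable P : polygraph31.

Inductive congr3 : forall (x y : cell0 P) (p q : path1 x y),
    cell2 p q -> cell2 p q -> Prop :=
| congr3_gen (A : gen3 P) : congr3 (src3 A) (tgt3 A)
| congr3_refl x y (p q : path1 x y) (f : cell2 p q) : congr3 f f
| congr3_sym x y (p q : path1 x y) (f g : cell2 p q) :
    congr3 f g -> congr3 g f
| congr3_trans x y (p q : path1 x y) (f g h : cell2 p q) :
    congr3 f g -> congr3 g h -> congr3 f h
| congr3_vcomp x y (p q r : path1 x y) (f f' : cell2 p q) (g g' : cell2 q r) :
    congr3 f f' -> congr3 g g' -> congr3 (vcomp f g) (vcomp f' g')
| congr3_inv x y (p q : path1 x y) (f f' : cell2 p q) :
    congr3 f f' -> congr3 (inv_cell f) (inv_cell f')
| congr3_hcomp x y z (p q : path1 x y) (p' q' : path1 y z)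
    (f f' : cell2 p q) (g g' : cell2 p' q') :
    congr3 f f' -> congr3 g g' -> congr3 (hcomp f g) (hcomp f' g').

(* The 2-cells p => q of the (2,1)-category presented by P, i.e. of the
   quotient of the free one by the generating 3-cells. *)
Definition presented_cell2 (x y : cell0 P) (p q : path1 x y) : Type :=
  classes (@congr3_refl x y p q) (@congr3_sym x y p q) (@congr3_trans x y p q).

Definition presented_cls (x y : cell0 P) (p q : path1 x y) (f : cell2 p q) :
    presented_cell2 p q :=
  cls (@congr3_refl x y p q) (@congr3_sym x y p q) (@congr3_trans x y p q) f.

Definition homotopy_basis : Prop :=
  forall (x y : cell0 P) (p q : path1 x y) (f g : cell2 p q),
    presented_cls f = presented_cls g.

End PresentedTwoOneCategory.

Definition coherent_presentation (P : polygraph31) (C : category) : Prop :=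
  isomorphic_categories (presented_category P) C /\ homotopy_basis P.

Section GarsideMonoids.
Variable M : monoidType.
Implicit Types f g h w : M.

Definition ldvd f h : Prop := exists g, h = (f * g)%g.
Definition rdvd f h : Prop := exists g, h = (g * f)%g.

Definition is_gcd (dvd : M -> M -> Prop) f g d : Prop :=
  [/\ dvd d f, dvd d g & forall e, dvd e f -> dvd e g -> dvd e d].

Definition is_lcm (dvd : M -> M -> Prop) f g m : Prop :=
  [/\ dvd f m, dvd g m & forall e, dvd f e -> dvd g e -> dvd m e].

Definition submonoid (S : set M) : Prop :=
  S 1%g /\ forall f g, S f -> S g -> S (f * g)%g.

Definition ldivisors w : set M := [set u | ldvd u w].
Definition rdivisors w : set M := [set u | rdvd u w].

(* M is a Garside monoid with Garside element w0. *)
Record garside (w0 : M) : Prop := Garside {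
  garside_lcancel : forall f g h, (f * g = f * h)%g -> g = h;
  garside_rcancel : forall f g h, (g * f = h * f)%g -> g = h;
  garside_length : exists lambda : M -> nat,
    (forall f g, lambda (f * g)%g >= lambda f + lambda g) /\
    (forall f, f <> 1%g -> lambda f <> 0);
  garside_lgcd : forall f g, exists d, is_gcd ldvd f g d;
  garside_rgcd : forall f g, exists d, is_gcd rdvd f g d;
  garside_llcm : forall f g, exists m, is_lcm ldvd f g m;
  garside_rlcm : forall f g, exists m, is_lcm rdvd f g m;
  garside_divisors : ldivisors w0 = rdivisors w0;
  garside_finite : finite_set (ldivisors w0);
  garside_generates : smallest submonoid (ldivisors w0) = setT }.

Lemma garside_mul_neq1 (w0 : M) (Mw0 : garside w0) f g :
  f <> 1%g -> (f * g)%g <> 1%g.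
Proof.
move=> f_neq1 fg1; have [lambda [lambdaM lambda0]] := garside_length Mw0.
have := lambdaM 1%g 1%g; rewrite mulg1 -[leqRHS]addn0 leq_add2l leqn0 => /eqP l1.
have := lambdaM f g; rewrite fg1 l1 leqn0 addn_eq0 => /andP[/eqP lf0 _].
exact: lambda0 lf0.
Qed.

End GarsideMonoids.

Section Garside3.
Variables (M : monoidType) (w0 : M) (Mw0 : garside w0).

Local Notation W := (ldivisors w0).

Record gar1 := Gar1 {
  gval : M;
  gar1_in : W gval;
  gar1_neq1 : gval <> 1%g }.

Definition gar_poly1 : polygraph1 :=
  @Polygraph1 unit gar1 (fun _ => tt) (fun _ => tt).

(* The word u_1|...|u_n, as a 1-cell. *)
Fixpoint gar_word (s : seq gar1) : @path1 gar_poly1 tt tt :=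
  if s is u :: s' then @path_cons gar_poly1 u tt (gar_word s')
  else @path_id gar_poly1 tt.

Definition gar_mul (u v : gar1) (uvW : W (gval u * gval v)%g) : gar1 :=
  Gar1 uvW (garside_mul_neq1 Mw0 (@gar1_neq1 u)).

Record gar2 := Gar2 {
  gar2_u : gar1;
  gar2_v : gar1;
  gar2_uv : W (gval gar2_u * gval gar2_v)%g }.

Definition gar_poly2 : polygraph2 :=
  @Polygraph2 gar_poly1 gar2 (fun _ => tt) (fun _ => tt)
    (fun a => gar_word [:: gar2_u a; gar2_v a])
    (fun a => gar_word [:: gar_mul (gar2_uv a)]).

Definition gar_alpha (u v : gar1) (uvW : W (gval u * gval v)%g) :
    @cell2 gar_poly2 tt tt (gar_word [:: u; v]) (gar_word [:: gar_mul uvW]) :=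
  @gen_cell gar_poly2 (Gar2 uvW).

Record gar3 := Gar3 {
  gar3_u : gar1;
  gar3_v : gar1;
  gar3_w : gar1;
  gar3_uv : W (gval gar3_u * gval gar3_v)%g;
  gar3_vw : W (gval gar3_v * gval gar3_w)%g;
  gar3_uvw : W (gval gar3_u * gval gar3_v * gval gar3_w)%g }.

Lemma gar_mulA_in (u v w : gar1) :
  W (gval u * gval v * gval w)%g -> W (gval u * (gval v * gval w))%g.
Proof. by rewrite mulgA. Qed.

Lemma gar1_inj (u v : gar1) : gval u = gval v -> u = v.
Proof.
case: u v => [u uW u1] [v vW v1] /= uv; case: v / uv in vW v1 *.
by rewrite (Prop_irrelevance uW vW) (Prop_irrelevance u1 v1).
Qed.

Section ThreeCell.
Variables u v w : gar1.
Variables (uvW : W (gval u * gval v)%g) (vwW : W (gval v * gval w)%g)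
  (uvwW : W (gval u * gval v * gval w)%g).

Local Notation uv := (gar_mul uvW).
Local Notation vw := (gar_mul vwW).
Local Notation uv_w := (@gar_mul uv w uvwW).
Local Notation u_vw := (@gar_mul u vw (gar_mulA_in uvwW)).

Lemma gar_mulA : gar_word [:: u_vw] = gar_word [:: uv_w].
Proof. by congr (gar_word [:: _]); apply: gar1_inj; rewrite /= mulgA. Qed.

Definition gar3_src :
    @cell2 gar_poly2 tt tt (gar_word [:: u; v; w]) (gar_word [:: uv_w]) :=
  vcomp (@whisker_r gar_poly2 tt tt tt _ _ (gar_alpha uvW) (gar_word [:: w]))
        (@gar_alpha uv w uvwW).

(* The cast replaces the target u(vw) with (uv)w. *)
Definition gar3_tgt :
    @cell2 gar_poly2 tt tt (gar_word [:: u; v; w]) (gar_word [:: uv_w]) :=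
  @cast_tgt gar_poly2 tt tt _ _ _ gar_mulA
    (vcomp (@whisker_l gar_poly2 tt tt tt (gar_word [:: u]) _ _ (gar_alpha vwW))
           (@gar_alpha u vw (gar_mulA_in uvwW))).

End ThreeCell.

Definition Gar_3 : polygraph31 :=
  @Polygraph31 gar_poly2 gar3 (fun _ => tt) (fun _ => tt)
    (fun A => gar_word [:: gar3_u A; gar3_v A; gar3_w A])
    (fun A => gar_word [:: @gar_mul (gar_mul (gar3_uv A)) (gar3_w A)
                             (gar3_uvw A)])
    (fun A => gar3_src (gar3_uv A) (gar3_uvw A))
    (fun A => gar3_tgt (gar3_uv A) (gar3_vw A) (gar3_uvw A)).

End Garside3.

(* Main.v *)
(* Coherence. Given a simple element [u] and a word [x|n], let [h] be the largest
   left divisor of [x] such that [u h] is simple, and write [x = h t]. The cells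
     u|x|n => u|h|t|n => uh|t|n,
   followed recursively by the cell that pushes [t] into [n], define a canonical
   2-cell from [u|n] to a word [u.n]. Induction on [n], using only the 3-cells
   [A_{u,v,w}], shows that pushing [v] then [u] is the same as contracting [u|v]
   by [alpha_{u,v}] and pushing [uv]. Iterating, every word gets a canonical
   2-cell to a normal form, which is natural with respect to all 2-cells; hence
   parallel 2-cells agree. Uniqueness of normal forms is never needed.

   Presentation. Two words [a|s] and [b|t] with the same value [x] are related
   through a word beginning with the lcm of [a] and [b], by induction on the
   length of [x]. *)

Require Import Defs.
From mathcomp Require Import all_boot.
From mathcomp Require Import boolp classical_sets.

Set Implicit Arguments.
Unset Strict Implicit.
Unset Printing Implicit Defensive.

Local Open Scope group_scope.

(** The equality of first components is a proof of [x = x], which proof irrelevance identifies with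
    [erefl]. *)
Lemma existT_inj (T : Type) (P : T -> Type) x (a b : P x) :
  existT P x a = existT P x b -> a = b.
Proof.
by move=> e; have := projT2_eq e; rewrite (Prop_irrelevance (projT1_eq e) erefl).
Qed.

Local Notation "p +++ q" := (path_cat p q) (at level 35, right associativity).

(** * Cancellation of 1-cells in the free category *)

Section PathCancellation.
Variable P : polygraph1.

Fixpoint path_seq (x y : cell0 P) (p : path1 x y) : seq (gen1 P) :=
  if p is path_cons a _ p' then a :: path_seq p' else [::].

Lemma path_seq_cat (x y z : cell0 P) (p : path1 x y) (q : path1 y z) :
  path_seq (p +++ q) = path_seq p ++ path_seq q.
Proof. by elim: p q => [//|a y' p IHp] q /=; rewrite IHp. Qed.

Lemma path_seq_inj (x y : cell0 P) : injective (@path_seq x y).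
Proof.
(* Endpoints must vary in the induction. Empty paths at different 0-cells have the same sequence, so
   equal sources are assumed; equal targets then follow. *)
suff key (p : path1 x y) x' y' (q : path1 x' y') (ex : x = x') :
    path_seq p = path_seq q ->
    existT (fun z => path1 z.1 z.2) (x, y) p =
    existT (fun z => path1 z.1 z.2) (x', y') q.
  by move=> p q e; apply: existT_inj (key p x y q erefl e).
elim: p x' y' q ex => [z|a z p IHp] x' y' [z'|a' z' q] //= ex.
  by rewrite ex.
case=> eaa'; subst a' => epq; have e := IHp _ _ q erefl epq.
have ez : z = z' by case: (projT1_eq e).
by subst z'; rewrite (existT_inj e).
Qed.

Lemma path_catI (x y z : cell0 P) (p : path1 x y) (q r : path1 y z) :
  p +++ q = p +++ r -> q = r.
Proof.
move=> /(congr1 (@path_seq x z)); rewrite !path_seq_cat => e.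
apply: path_seq_inj; have := congr1 (drop (size (path_seq p))) e.
by rewrite !drop_size_cat.
Qed.

Lemma path_catIr (x y z : cell0 P) (p q : path1 x y) (r : path1 y z) :
  p +++ r = q +++ r -> p = q.
Proof.
move=> /(congr1 (@path_seq x z)); rewrite !path_seq_cat => e.
have size_pq : size (path_seq p) = size (path_seq q).
  by move/(congr1 size): e; rewrite !size_cat => /addIn.
apply: path_seq_inj; have := congr1 (take (size (path_seq p))) e.
by rewrite take_size_cat // take_size_cat.
Qed.
End PathCancellation.

(** * Calculus of 2-cells modulo the generating 3-cells *)

Section Arrows.
Variables (P : polygraph31) (x0 : cell0 P).

Local Notation path := (@path1 P x0 x0).

(** Packing a 2-cell with its boundary turns the strict laws, whose two sides have boundaries equal
    but not convertible, into plain equalities that can be rewritten with. *)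
Record arrow := Arrow {
  arrow_dom : path;
  arrow_cod : path;
  arrow_cell : presented_cell2 arrow_dom arrow_cod }.

Definition tcell (p q : path) (f : term2 p q) : option arrow :=
  Some (Arrow (presented_cls (term_cell f))).

Definition arrow_of (f : option arrow) (p q : path) : Prop :=
  exists t : term2 p q, f = tcell t.

Lemma arrow_ofP (f : option arrow) :
  f = None \/ exists p q, arrow_of f p q.
Proof.
case: f => [[p q c]|]; [right|by left].
by exists p, q, (rep (rep c)); rewrite /tcell /presented_cls /term_cell !repK.
Qed.

Lemma presented_term_eqP (p q : path) (f g : term2 p q) :
  presented_cls (term_cell f) = presented_cls (term_cell g) <->
  tcell f = tcell g.
Proof.
rewrite /tcell; split=> [->//|[e]].
by apply: existT_inj (existT_inj e).
Qed.

Lemma tcell_eqt (p q p' q' : path) (f : term2 p q) (g : term2 p' q') :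
  eqt f g -> tcell f = tcell g.
Proof.
move=> fg; have [ep eq] := eqt_boundary fg; subst p' q'.
by rewrite /tcell; congr (Some (Arrow _)); congr presented_cls; apply/clsP.
Qed.

Definition ivert (f : option arrow) : option arrow :=
  if f is Some (Arrow p q c) then tcell (tinv (rep (rep c))) else None.

Definition horiz (f g : option arrow) : option arrow :=
  if f is Some (Arrow p q c) then
    if g is Some (Arrow r s d) then tcell (thcomp (rep (rep c)) (rep (rep d)))
    else None
  else None.

(* [None] is the result of composing cells whose boundaries do not match: this
   makes associativity unconditional. *)
Definition vert (f g : option arrow) : option arrow :=
  if f is Some (Arrow p q c) then
    if g is Some (Arrow r s d) then
      if pselect (q = r) is left e then
        tcell (tvcomp (rep (rep c)) (ecast q (term2 q s) (esym e) (rep (rep d))))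
      else None
    else None
  else None.

Definition iarr (p : path) : option arrow := tcell (tid p).

Local Notation "f \; g" := (vert f g) (at level 60, right associativity).
Local Notation "f ** g" := (horiz f g) (at level 45, right associativity).

(** There are two layers of quotient: the inner [rep] chooses a 2-cell of the free (2,1)-category,
    the outer one a term for it. *)
Lemma congr3_rep (p q : path) (f : term2 p q) :
  congr3 (term_cell (rep (rep (presented_cls (term_cell f))))) (term_cell f).
Proof. by rewrite {1}/term_cell repK; apply: rep_cls. Qed.

Lemma tcell_congr3 (p q : path) (f g : term2 p q) :
  congr3 (term_cell f) (term_cell g) -> tcell f = tcell g.
Proof. by move=> fg; apply/presented_term_eqP/clsP. Qed.

Lemma tcell_inv (p q : path) (f : term2 p q) :
  ivert (tcell f) = tcell (tinv f).
Proof.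
apply: tcell_congr3; rewrite -!term_cell_inv.
by apply: congr3_inv; apply: congr3_rep.
Qed.

Lemma tcell_horiz (p q r s : path) (f : term2 p q) (g : term2 r s) :
  tcell f ** tcell g = tcell (thcomp f g).
Proof.
apply: tcell_congr3; rewrite -!term_cell_hcomp.
by apply: congr3_hcomp; apply: congr3_rep.
Qed.

Lemma tcell_vert (p q r : path) (f : term2 p q) (g : term2 q r) :
  tcell f \; tcell g = tcell (tvcomp f g).
Proof.
rewrite /vert /tcell; case: pselect => // e.
rewrite (Prop_irrelevance e erefl) /=.
apply: tcell_congr3; rewrite -!term_cell_vcomp.
by apply: congr3_vcomp; apply: congr3_rep.
Qed.

Lemma tcell_vert0 (p q r s : path) (f : term2 p q) (g : term2 r s) :
  q <> r -> tcell f \; tcell g = None.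
Proof. by rewrite /vert /tcell; case: pselect. Qed.

Lemma horizx0 f : f ** None = None. Proof. by case: f => [[]|]. Qed.

Lemma vertx0 f : f \; None = None. Proof. by case: f => [[]|]. Qed.

Lemma horizA f g h : f ** g ** h = (f ** g) ** h.
Proof.
have [->//|[p [q [tf ->]]]] := arrow_ofP f.
have [->|[r [s [tg ->]]]] := arrow_ofP g; first by rewrite !horizx0.
have [->|[u [v [th ->]]]] := arrow_ofP h; first by rewrite !horizx0.
by rewrite !tcell_horiz; apply: tcell_eqt; apply: eqt_hcompA.
Qed.

Lemma vertA f g h : f \; g \; h = (f \; g) \; h.
Proof.
have [->//|[p [q [tf ->]]]] := arrow_ofP f.
have [->|[r [s [tg ->]]]] := arrow_ofP g; first by rewrite !vertx0.
have [->|[u [v [th ->]]]] := arrow_ofP h; first by rewrite !vertx0.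
have [qr|qr] := pselect (q = r); last first.
  rewrite (tcell_vert0 _ _ qr); have [su|su] := pselect (s = u).
    by subst u; rewrite tcell_vert tcell_vert0.
  by rewrite (tcell_vert0 _ _ su).
subst r; rewrite (tcell_vert tf tg); have [su|su] := pselect (s = u).
  by subst u; rewrite !tcell_vert; apply: tcell_eqt; apply: eqt_vcompA.
by rewrite !(tcell_vert0 _ _ su).
Qed.

Lemma horiz1x f : iarr (path_id x0) ** f = f.
Proof.
have [->|[p [q [tf ->]]]] := arrow_ofP f; first exact: horizx0.
by rewrite tcell_horiz; apply: tcell_eqt; apply: eqt_hcomp1f.
Qed.

Lemma horizx1 f : f ** iarr (path_id x0) = f.
Proof.
have [->//|[p [q [tf ->]]]] := arrow_ofP f.
by rewrite tcell_horiz; apply: tcell_eqt; apply: eqt_hcompf1.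
Qed.

Lemma iarr_cat p q : iarr (p +++ q) = iarr p ** iarr q.
Proof.
by rewrite tcell_horiz; apply/esym/tcell_eqt; apply: eqt_hcomp_id.
Qed.

Lemma arrow_iarr p : arrow_of (iarr p) p p. Proof. by eexists. Qed.

Lemma arrow_tcell p q (f : term2 p q) : arrow_of (tcell f) p q.
Proof. by exists f. Qed.

Lemma arrow_vert f g p q r :
  arrow_of f p q -> arrow_of g q r -> arrow_of (f \; g) p r.
Proof. by case=> s -> [t ->]; rewrite tcell_vert; eexists. Qed.

Lemma arrow_horiz f g p q r s :
  arrow_of f p q -> arrow_of g r s -> arrow_of (f ** g) (p +++ r) (q +++ s).
Proof. by case=> t -> [u ->]; rewrite tcell_horiz; eexists. Qed.

Lemma arrow_inv f p q : arrow_of f p q -> arrow_of (ivert f) q p.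
Proof. by case=> t ->; rewrite tcell_inv; eexists. Qed.

Lemma vert1x f p q : arrow_of f p q -> iarr p \; f = f.
Proof.
by case=> t ->; rewrite tcell_vert; apply: tcell_eqt; apply: eqt_vcomp1f.
Qed.

Lemma vertx1 f p q : arrow_of f p q -> f \; iarr q = f.
Proof.
by case=> t ->; rewrite tcell_vert; apply: tcell_eqt; apply: eqt_vcompf1.
Qed.

Lemma vertxV f p q : arrow_of f p q -> f \; ivert f = iarr p.
Proof.
case=> t ->; rewrite tcell_inv tcell_vert; apply: tcell_eqt.
exact: eqt_vcompfV.
Qed.

Lemma vertVx f p q : arrow_of f p q -> ivert f \; f = iarr q.
Proof.
case=> t ->; rewrite tcell_inv tcell_vert; apply: tcell_eqt.
exact: eqt_vcompVf.
Qed.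

Lemma exchange f f' g g' p q r p' q' r' :
  arrow_of f p q -> arrow_of g q r -> arrow_of f' p' q' -> arrow_of g' q' r' ->
  (f \; g) ** (f' \; g') = (f ** f') \; (g ** g').
Proof.
case=> tf -> [tg ->] [tf' ->] [tg' ->].
rewrite (tcell_vert tf tg) (tcell_vert tf' tg') !tcell_horiz tcell_vert.
apply: tcell_eqt.
exact: eqt_exchange.
Qed.

(** If the boundaries of [f] and [g] do not match, cancellation of 1-cells shows that those of the
    whiskered cells do not match either, and both sides are [None]. *)
Lemma horiz_vertr p f g : iarr p ** (f \; g) = (iarr p ** f) \; (iarr p ** g).
Proof.
have [->//|[q [r [tf ->]]]] := arrow_ofP f.
have [->|[s [t [tg ->]]]] := arrow_ofP g; first by rewrite !(vertx0, horizx0).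
have [rs|rs] := pselect (r = s).
  subst s; rewrite -{1}(vert1x (arrow_iarr p)).
  by rewrite (exchange (arrow_iarr p) (arrow_iarr p) (arrow_tcell tf)
    (arrow_tcell tg)).
rewrite (tcell_vert0 _ _ rs) horizx0 !tcell_horiz tcell_vert0 //.
by move=> /path_catI.
Qed.

Lemma horiz_vertl p f g : (f \; g) ** iarr p = (f ** iarr p) \; (g ** iarr p).
Proof.
have [->//|[q [r [tf ->]]]] := arrow_ofP f.
have [->|[s [t [tg ->]]]] := arrow_ofP g; first by rewrite !(vertx0, horizx0).
have [rs|rs] := pselect (r = s).
  subst s; rewrite -{1}(vert1x (arrow_iarr p)).
  by rewrite (exchange (arrow_tcell tf) (arrow_tcell tg) (arrow_iarr p)
    (arrow_iarr p)).
rewrite (tcell_vert0 _ _ rs) !tcell_horiz tcell_vert0 //.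
by move=> /path_catIr.
Qed.

Lemma horizE f g p q r s : arrow_of f p q -> arrow_of g r s ->
  f ** g = (f ** iarr r) \; (iarr q ** g).
Proof.
move=> fpq grs; rewrite -(exchange fpq (arrow_iarr q) (arrow_iarr r) grs).
by rewrite (vertx1 fpq) (vert1x grs).
Qed.

(** By the exchange law both sides equal [f ** g]. *)
Lemma slide f g p q r s : arrow_of f p q -> arrow_of g r s ->
  (f ** iarr r) \; (iarr q ** g) = (iarr p ** g) \; (f ** iarr s).
Proof.
move=> fpq grs; rewrite -(horizE fpq grs).
rewrite -(exchange (arrow_iarr p) fpq grs (arrow_iarr s)).
by rewrite (vert1x fpq) (vertx1 grs).
Qed.

Lemma cell_term (p q : path) (c : cell2 p q) : exists t, c = term_cell t.
Proof. by exists (rep c); rewrite /term_cell repK. Qed.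

Lemma iarr_inv p : ivert (iarr p) = iarr p.
Proof.
by rewrite -(vertx1 (arrow_inv (arrow_iarr p))) (vertVx (arrow_iarr p)).
Qed.

(** Composing with the inverse of [k] leaves the identity of [q] in front, since nothing is assumed
    about the sources of [f] and [g]. *)
Lemma vert_cancel k p q f g :
  arrow_of k p q -> k \; f = k \; g -> iarr q \; f = iarr q \; g.
Proof. by move=> kpq e; rewrite -(vertVx kpq) -!vertA e. Qed.

Lemma vert_rewr f g h k : f \; g = h -> f \; g \; k = h \; k.
Proof. by move=> <-; rewrite vertA. Qed.

Definition carr (p q : path) (c : cell2 p q) : option arrow :=
  Some (Arrow (presented_cls c)).

Lemma carr_congr3 p q (c d : cell2 p q) : congr3 c d -> carr c = carr d.
Proof. by move=> cd; rewrite /carr; congr (Some (Arrow _)); apply/clsP. Qed.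

Lemma carr_cast p q q' (e : q = q') (c : cell2 p q) :
  carr (cast_tgt e c) = carr c.
Proof. by case: q' / e. Qed.

Lemma carr_vcomp p q r (c : cell2 p q) (d : cell2 q r) :
  carr (vcomp c d) = carr c \; carr d.
Proof.
have [t ->] := cell_term c; have [t' ->] := cell_term d.
by rewrite term_cell_vcomp -[LHS]/(tcell _) -tcell_vert.
Qed.

Lemma carr_hcomp p q r s (c : cell2 p q) (d : cell2 r s) :
  carr (hcomp c d) = carr c ** carr d.
Proof.
have [t ->] := cell_term c; have [t' ->] := cell_term d.
by rewrite term_cell_hcomp -[LHS]/(tcell _) -tcell_horiz.
Qed.

End Arrows.

Arguments tcell : simpl never.
Arguments vert : simpl never.
Arguments horiz : simpl never.
Arguments ivert : simpl never.

(** * Simple elements, heads and tails *)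

Section Garside.
Variables (M : monoidType) (w0 : M) (Mw0 : garside w0).
Implicit Types (f g h u v w x y z : M) (n : seq M).

Local Notation W := (ldivisors w0).

Lemma simple_ldvd f g : W (f * g) -> W f.
Proof. by case=> h ->; exists (g * h); rewrite mulgA. Qed.

Lemma simple_rdvd f g : W (f * g) -> W g.
Proof.
rewrite (garside_divisors Mw0) => -[h w0E].
by exists (h * f); rewrite w0E mulgA.
Qed.

Lemma simple_mulA u v w : W (u * v * w) -> W (u * (v * w)).
Proof. by rewrite mulgA. Qed.

Lemma ldvd_anti f g : ldvd f g -> ldvd g f -> f = g.
Proof.
case=> a -> [b /eqP]; rewrite -mulgA -{1}[f]mulg1 => /eqP.
move=> /(garside_lcancel Mw0)/esym ab1.
have [->|/(garside_mul_neq1 Mw0 (g := b))/(_ ab1)//] := pselect (a = 1).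
by rewrite mulg1.
Qed.

Lemma mulg_eq1r f g : f * g = 1 -> g = 1.
Proof.
move=> fg1; have [f1|/(garside_mul_neq1 Mw0 (g := g))/(_ fg1)//] := pselect (f = 1).
by rewrite -fg1 f1 mul1g.
Qed.

Lemma ldvd_mul2l f g h : ldvd (f * g) (f * h) <-> ldvd g h.
Proof.
split=> -[k e]; exists k; last by rewrite e mulgA.
by apply: (garside_lcancel Mw0 (f := f)); rewrite e mulgA.
Qed.

Lemma ldvd_trans f g h : ldvd f g -> ldvd g h -> ldvd f h.
Proof. by case=> a -> [b ->]; exists (a * b); rewrite mulgA. Qed.

Definition is_head u x : set M := [set y |
  [/\ ldvd y x, W (u * y) & forall z, ldvd z x -> W (u * z) -> ldvd z y]]%classic.

Definition head_of u x : M := xget 1 (is_head u x).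

Definition tail_of u x : M := xget 1 [set z | x = head_of u x * z]%classic.

(* The head of [x] after [u] is the gcd of [x] and the complement of [u]. *)
Lemma head_ofP u x : W u -> is_head u x (head_of u x).
Proof.
case=> c w0E; have [d [dx dc maxd]] := garside_lgcd Mw0 x c.
apply: (@xgetPex _ 1 (is_head u x)); exists d; split=> //.
  by case: dc => e cE; exists e; rewrite w0E cE mulgA.
by move=> z zx [e]; rewrite w0E -mulgA => /(garside_lcancel Mw0) cE;
  apply: maxd => //; exists e.
Qed.

Lemma head_tail u x : W u -> x = head_of u x * tail_of u x.
Proof.
move=> /head_ofP-/(_ x)[[z xE] _ _].
by apply: (@xgetPex _ 1 [set z | x = head_of u x * z]%classic); exists z.
Qed.

Lemma simple_head u x : W u -> W (u * head_of u x).
Proof. by move=> /head_ofP-/(_ x)[]. Qed.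

Lemma tail_uniq u x z : W u -> x = head_of u x * z -> tail_of u x = z.
Proof.
by move=> Wu; rewrite {1}(head_tail x Wu) => /(garside_lcancel Mw0).
Qed.

Lemma head_all u x : W (u * x) -> head_of u x = x.
Proof.
move=> Wux; have [hx _ maxh] := head_ofP x (simple_ldvd Wux).
by apply: ldvd_anti => //; apply: maxh => //; exists 1; rewrite mulg1.
Qed.

Lemma tail_all u x : W (u * x) -> tail_of u x = 1.
Proof.
move=> Wux; apply: tail_uniq; first exact: simple_ldvd Wux.
by rewrite head_all ?mulg1.
Qed.

(** Since [u * v] is simple, [v] divides the left-hand side; once [v] is cancelled, the two
    remaining elements divide each other by the maximality of the heads. *)
Lemma head_mul u v x : W (u * v) ->
  head_of u (v * head_of v x) = v * head_of (u * v) x.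
Proof.
move=> Wuv; have Wu := simple_ldvd Wuv; have Wv := simple_rdvd Wuv.
have [hx Wuvh maxh] := head_ofP x Wuv.
have [h'x _ maxh'] := head_ofP x Wv.
have [kx Wuk maxk] := head_ofP (v * head_of v x) Wu.
have vk : ldvd v (head_of u (v * head_of v x)) by apply: maxk => //; eexists.
case: vk => y kE; rewrite kE in kx Wuk maxk *; congr (v * _).
move: kx => /ldvd_mul2l yh'; rewrite mulgA in Wuk.
apply: ldvd_anti; first exact: maxh (ldvd_trans yh' h'x) Wuk.
apply/(ldvd_mul2l v); apply: maxk; last by rewrite mulgA.
by apply/ldvd_mul2l; apply: maxh' => //; apply: simple_rdvd (u) _ _; rewrite mulgA.
Qed.

Lemma head_split u v x : W (u * v) ->
  head_of v x = head_of (u * v) x * tail_of u (v * head_of v x).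
Proof.
move=> Wuv; apply: (garside_lcancel Mw0 (f := v)).
by rewrite mulgA -head_mul // -head_tail //; apply: simple_ldvd Wuv.
Qed.

Lemma tail_split u v x : W (u * v) ->
  tail_of (u * v) x = tail_of u (v * head_of v x) * tail_of v x.
Proof.
move=> Wuv; apply: tail_uniq => //; rewrite mulgA -head_split //.
by apply: head_tail; apply: simple_rdvd Wuv.
Qed.

(** * Contraction cells, their associativity and a pentagon *)

Local Notation P := (Gar_3 Mw0).
Local Notation path := (@path1 P tt tt).
Local Notation "f \; g" := (vert f g) (at level 60, right associativity).
Local Notation "f ** g" := (horiz f g) (at level 45, right associativity).
Local Notation I := (@iarr P tt).

Definition proper u : Prop := W u /\ u <> 1.

(* The word [u], with [1] erased (and junk value the empty word when [u] does
   not divide [w0]). *)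
Definition hat u : path :=
  if pselect (proper u) is left pu then gar_word [:: Gar1 pu.1 pu.2]
  else @path_id P tt.

Local Notation J u := (iarr (hat u)).

Definition gen_arrow (a : gar2 w0) : option (@arrow P tt) :=
  @tcell P tt _ _ (@tgen P a).

(* [alpha_{u,v}], extended by the identity to [u = 1] and [v = 1] (junk: also
   when [u v] does not divide [w0]). *)
Definition alpha u v : option (@arrow P tt) :=
  match pselect (proper u), pselect (proper v), pselect (W (u * v)) with
  | left pu, left pv, left puv =>
    gen_arrow (@Gar2 _ _ (Gar1 pu.1 pu.2) (Gar1 pv.1 pv.2) puv)
  | _, _, _ => I (hat u +++ hat v)
  end.

Lemma hat_gval (u : gar1 w0) : hat (gval u) = gar_word [:: u].
Proof.
rewrite /hat; case: pselect => [pu|[]]; last by split; case: u.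
by congr (gar_word [:: _]); apply: gar1_inj.
Qed.

Lemma hat1 : hat 1 = @path_id P tt.
Proof. by rewrite /hat; case: pselect => // -[]. Qed.

Lemma gar2_inj (a b : gar2 w0) :
  gar2_u a = gar2_u b -> gar2_v a = gar2_v b -> a = b.
Proof.
case: a b => [u v uvW] [u' v' uvW'] /= eu ev; subst u' v'.
by rewrite (Prop_irrelevance uvW uvW').
Qed.

Lemma alpha_gval (u v : gar1 w0) (uvW : W (gval u * gval v)) :
  alpha (gval u) (gval v) = gen_arrow (Gar2 uvW).
Proof.
rewrite /alpha; case: pselect => [pu|[]]; last by split; case: u {uvW}.
case: pselect => [pv|[]]; last by split; case: v {uvW}.
case: pselect => [puv|//].
by congr gen_arrow; apply: gar2_inj; apply: gar1_inj.
Qed.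

Lemma alpha1x v : alpha 1 v = J v.
Proof.
by rewrite /alpha; case: pselect => [[]//|_]; rewrite hat1.
Qed.

Lemma alphax1 u : alpha u 1 = J u.
Proof.
rewrite /alpha; case: pselect => [?|_]; last by rewrite hat1 path_catp1.
by case: pselect => [[]//|_]; rewrite hat1 path_catp1.
Qed.

Lemma simpleP u : W u -> u = 1 \/ exists g : gar1 w0, u = gval g.
Proof.
by move=> Wu; have [->|u1] := pselect (u = 1); [left|right; exists (Gar1 Wu u1)].
Qed.

Lemma arrow_alpha u v : W (u * v) ->
  arrow_of (alpha u v) (hat u +++ hat v) (hat (u * v)).
Proof.
move=> Wuv; have [u1|[g ug]] := simpleP (simple_ldvd Wuv).
  by rewrite u1 alpha1x hat1 mul1g; apply: arrow_iarr.
have [v1|[h vh]] := simpleP (simple_rdvd Wuv).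
  by rewrite v1 alphax1 hat1 path_catp1 mulg1; apply: arrow_iarr.
subst u v; rewrite alpha_gval !hat_gval.
by rewrite (hat_gval (gar_mul Mw0 Wuv)); apply: arrow_tcell.
Qed.

(** For three nontrivial letters this is the 3-cell [A_{u,v,w}]; if one of them is [1], it reduces
    to unit laws. *)
Lemma alphaA u v w : W (u * v * w) ->
  (alpha u v ** J w) \; alpha (u * v) w =
  (J u ** alpha v w) \; alpha u (v * w).
Proof.
move=> Wuvw; have Wuv := simple_ldvd Wuvw.
have Wvw := simple_rdvd (simple_mulA Wuvw).
have [u1|[gu ug]] := simpleP (simple_ldvd Wuv).
  rewrite u1 !alpha1x hat1 horiz1x mul1g -iarr_cat.
  by rewrite (vert1x (arrow_alpha Wvw)) (vertx1 (arrow_alpha Wvw)).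
have [v1|[gv vg]] := simpleP (simple_rdvd Wuv).
  by rewrite v1 alphax1 alpha1x mul1g mulg1.
have [w1|[gw wg]] := simpleP (simple_rdvd Wuvw).
  rewrite w1 !alphax1 hat1 horizx1 mulg1 -iarr_cat.
  by rewrite (vert1x (arrow_alpha Wuv)) (vertx1 (arrow_alpha Wuv)).
subst u v w.
have carr_alpha (a b : gar1 w0) (abW : W (gval a * gval b)) :
    @carr P tt _ _ (gar_alpha Mw0 abW) = alpha (gval a) (gval b).
  by rewrite alpha_gval.
have carr_hat (a : gar1 w0) :
    @carr P tt _ _ (@id_cell P tt tt (gar_word [:: a])) = J (gval a).
  by rewrite hat_gval.
have := carr_congr3 (x0 := tt : cell0 P)
  (congr3_gen (P := P) (Gar3 Wuv Wvw Wuvw)).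
rewrite -(carr_hat gu) -(carr_hat gw) -(carr_alpha _ _ Wuv) -(carr_alpha _ _ Wvw).
rewrite -(carr_alpha (gar_mul Mw0 Wuv) gw Wuvw).
rewrite -(carr_alpha gu (gar_mul Mw0 Wvw) (simple_mulA Wuvw)).
(* Passing to arrows absorbs the cast in the target of the 3-cell. *)
rewrite -!carr_hcomp -!carr_vcomp /= /gar3_tgt carr_cast.
rewrite (Prop_irrelevance (gar_mulA_in Wuvw) (simple_mulA Wuvw)).
exact.
Qed.

Local Notation beta u v := (ivert (alpha u v)).

Lemma arrow_beta u v : W (u * v) ->
  arrow_of (beta u v) (hat (u * v)) (hat u +++ hat v).
Proof. by move=> /arrow_alpha/arrow_inv. Qed.

(** This compares the two ways of pushing [u|v] through a single letter [x1 * x2 * x3]. It combines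
    [alphaA] for the triples [(x1, x2, x3)], [(v, x1, x2)] and [(u, v, x1)] with interchanges. *)
Lemma alpha_pentagon u v x1 x2 x3 :
  W (u * v * x1) -> W (v * (x1 * x2)) -> W (x1 * x2 * x3) ->
  (J u ** J v ** beta (x1 * x2) x3) \; (J u ** alpha v (x1 * x2) ** J x3) \;
  (J u ** beta (v * x1) x2 ** J x3) \; (alpha u (v * x1) ** J x2 ** J x3) \;
  (J (u * v * x1) ** alpha x2 x3) =
  (alpha u v ** J (x1 * x2 * x3)) \; (J (u * v) ** beta x1 (x2 * x3)) \;
  (alpha (u * v) x1 ** J (x2 * x3)).
Proof.
move=> Wuvx Wvxx Wxxx.
have Wuv := simple_ldvd Wuvx.
have Wxx := simple_ldvd Wxxx.
have Wxx' := simple_rdvd (simple_mulA Wxxx).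
have Wvxx' : W (v * x1 * x2) by rewrite -mulgA.
set l2 := J u ** alpha v _ ** _; set l3 := J u ** beta _ _ ** _.
set l4 := alpha u (v * x1) ** _; set l5 := J (u * v * x1) ** _.
set l1 := J u ** J v ** _.
set r1 := alpha u v ** _; set r2 := J (u * v) ** _.
set r3 := alpha (u * v) x1 ** J (x2 * x3).
(* Precomposing with the invertible [k], which starts from the fully split word [u|v|x1|x2|x3], lets
   each [beta] cancel against an [alpha]. *)
pose k := J u ** J v ** ((alpha x1 x2 ** J x3) \; alpha (x1 * x2) x3).
have kE : k = (J u ** J v ** alpha x1 x2 ** J x3) \;
              (J u ** J v ** alpha (x1 * x2) x3) by rewrite /k !horiz_vertr.
have kE' : k = (J u ** J v ** J x1 ** alpha x2 x3) \;
               (J u ** J v ** alpha x1 (x2 * x3)).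
  by rewrite /k alphaA // !horiz_vertr.
have ak := arrow_horiz (arrow_iarr (hat u)) (arrow_horiz (arrow_iarr (hat v))
  (arrow_vert (arrow_horiz (arrow_alpha Wxx) (arrow_iarr (hat x3)))
              (arrow_alpha Wxxx))).
(* The identities inserted in front of both sides are those that [vert_cancel] produces. *)
have l1E : iarr (hat u +++ hat v +++ hat (x1 * x2 * x3)) \; l1 = l1.
  by rewrite !iarr_cat -!horiz_vertr (vert1x (arrow_beta Wxxx)).
have r1E : iarr (hat u +++ hat v +++ hat (x1 * x2 * x3)) \; r1 = r1.
  by rewrite path_catA iarr_cat -!horiz_vertl (vert1x (arrow_alpha Wuv)).
rewrite -l1E -r1E -!vertA; apply: (vert_cancel ak); rewrite -/k {l1E r1E ak}.
rewrite {1}kE kE' -!vertA.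
have e1 : (J u ** J v ** alpha (x1 * x2) x3) \; l1 =
          (J u ** J v ** J (x1 * x2) ** J x3).
  by rewrite -!horiz_vertr (vertxV (arrow_alpha Wxxx)) iarr_cat.
have e2 : (J u ** J v ** J (x1 * x2) ** J x3) \; l2 = l2.
  rewrite /l2 [J v ** _]horizA -iarr_cat -!horiz_vertr -!horiz_vertl.
  by rewrite (vert1x (arrow_alpha Wvxx)).
have e3 : (J u ** J v ** alpha x1 x2 ** J x3) \; l2 =
    (J u ** alpha v x1 ** J x2 ** J x3) \; (J u ** alpha (v * x1) x2 ** J x3).
  have := congr1 (fun c => J u ** c ** J x3) (alphaA Wvxx').
  by rewrite !(horiz_vertl, horiz_vertr) -!horizA.
have e4 : (J u ** alpha (v * x1) x2 ** J x3) \; l3 =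
    J u ** J (v * x1) ** J x2 ** J x3.
  rewrite -!horiz_vertr -!horiz_vertl (vertxV (arrow_alpha Wvxx')) iarr_cat.
  by rewrite -horizA.
have e5 : (J u ** J (v * x1) ** J x2 ** J x3) \; l4 = l4.
  rewrite /l4 [J u ** _]horizA -[J u ** J _]iarr_cat -[J x2 ** _]iarr_cat.
  rewrite -!horiz_vertl.
  by rewrite (vert1x (arrow_alpha (simple_mulA Wuvx))).
have e6 : (J u ** alpha v x1 ** J x2 ** J x3) \; l4 =
    (alpha u v ** J x1 ** J x2 ** J x3) \; (alpha (u * v) x1 ** J x2 ** J x3).
  rewrite /l4 -![J x2 ** J x3]iarr_cat.
  have := congr1 (fun c => c ** I (hat x2 +++ hat x3)) (alphaA Wuvx).
  by rewrite !horiz_vertl -!horizA.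
have e7 : (alpha (u * v) x1 ** J x2 ** J x3) \; l5 =
    (J (u * v) ** J x1 ** alpha x2 x3) \; r3.
  have := slide (arrow_alpha Wuvx) (arrow_alpha Wxx').
  by rewrite !iarr_cat -!horizA.
have e8 : (J u ** J v ** alpha x1 (x2 * x3)) \; r1 =
    (alpha u v ** J x1 ** J (x2 * x3)) \; (J (u * v) ** alpha x1 (x2 * x3)).
  rewrite -mulgA in Wxxx.
  have := slide (arrow_alpha Wuv) (arrow_alpha Wxxx).
  by rewrite !iarr_cat -!horizA mulgA.
have e9 : (J (u * v) ** alpha x1 (x2 * x3)) \; r2 =
    J (u * v) ** J x1 ** J (x2 * x3).
  by rewrite -horiz_vertr (vertxV (arrow_alpha _)) ?iarr_cat // mulgA.
have e10 : (J (u * v) ** J x1 ** J (x2 * x3)) \; r3 = r3.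
  rewrite /r3 [J (u * v) ** _]horizA -iarr_cat -!horiz_vertl.
  by rewrite (vert1x (arrow_alpha Wuvx)).
have e11 : (J u ** J v ** J x1 ** alpha x2 x3) \;
    (alpha u v ** J x1 ** J (x2 * x3)) =
    (alpha u v ** J x1 ** J x2 ** J x3) \; (J (u * v) ** J x1 ** alpha x2 x3).
  have := slide (arrow_alpha Wuv)
    (arrow_horiz (arrow_iarr (hat x1)) (arrow_alpha Wxx')).
  by rewrite !iarr_cat -!horizA.
rewrite (vert_rewr _ e1) (vert_rewr _ e2) (vert_rewr _ e3) -!vertA.
rewrite (vert_rewr _ e4) (vert_rewr _ e5) (vert_rewr _ e6) -!vertA e7.
rewrite (vert_rewr _ e8) -!vertA (vert_rewr _ e9) e10.
by rewrite (vert_rewr _ e11) -!vertA.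
Qed.

(** * Pushing a simple element into a word *)

Fixpoint simples n : Prop := if n is x :: n' then W x /\ simples n' else True.

Fixpoint wpath n : path :=
  if n is x :: n' then hat x +++ wpath n' else @path_id P tt.

(** Erasing a final [1] makes [act u [:: v]] equal to [[:: u * v]] when [u * v] is simple, as
    compatibility with products requires. *)
Fixpoint act u n : seq M :=
  if n is x :: n' then u * head_of u x :: act (tail_of u x) n'
  else if u == 1 then [::] else [:: u].

(* The canonical 2-cell from [u|n] to [act u n], which lets [u] absorb the head
   of the first letter of [n] and then moves on with the tail of that letter. *)
Fixpoint act_cell u n : option (@arrow P tt) :=
  if n is x :: n' then
    (J u ** beta (head_of u x) (tail_of u x) ** I (wpath n')) \;
    (alpha u (head_of u x) ** J (tail_of u x) ** I (wpath n')) \;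
    (J (u * head_of u x) ** act_cell (tail_of u x) n')
  else J u.

Lemma simple_tail u x : W u -> W x -> W (tail_of u x).
Proof. by move=> Wu; rewrite {1}(head_tail x Wu) => /simple_rdvd. Qed.

Lemma act_simple u n : W u -> simples n -> simples (act u n).
Proof.
elim: n u => [|x n IHn] u Wu /=; first by case: eqP.
case=> Wx Wn; split; first exact: simple_head.
by apply: IHn => //; apply: simple_tail.
Qed.

Lemma arrow_act_cell u n : W u -> simples n ->
  arrow_of (act_cell u n) (hat u +++ wpath n) (wpath (act u n)).
Proof.
elim: n u => [|x n IHn] u Wu /=.
  move=> _; rewrite path_catp1; case: eqP => [->|_] /=.
    by rewrite hat1; apply: arrow_iarr.
  by rewrite path_catp1; apply: arrow_iarr.
case=> Wx Wn; have Wt := simple_tail Wu Wx.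
have Wht : W (head_of u x * tail_of u x) by rewrite -head_tail.
have a1 := arrow_horiz (arrow_iarr (hat u))
  (arrow_horiz (arrow_beta Wht) (arrow_iarr (wpath n))).
have a2 := arrow_horiz (arrow_alpha (simple_head x Wu))
  (arrow_horiz (arrow_iarr (hat (tail_of u x))) (arrow_iarr (wpath n))).
have a3 := arrow_horiz (arrow_iarr (hat (u * head_of u x))) (IHn _ Wt Wn).
rewrite -{1}head_tail // in a1; rewrite -!path_catA in a1 a2.
exact: arrow_vert a1 (arrow_vert a2 a3).
Qed.

(** On a first letter [x1 * x2 * x3], both procedures output [u * v * x1]; one then pushes [x3] and
    next [x2] into the rest, the other pushes [x2 * x3]. The induction hypothesis compares these,
    and [alpha_pentagon] deals with the first letter. *)
Lemma act_mul u v n : W (u * v) -> simples n ->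
  act u (act v n) = act (u * v) n /\
  (J u ** act_cell v n) \; act_cell u (act v n) =
  (alpha u v ** I (wpath n)) \; act_cell (u * v) n.
Proof.
elim: n u v => [|x n IHn] u v Wuv.
  move=> _ /=; have Wu := simple_ldvd Wuv.
  case: (v =P 1) => [v1|v1] /=.
    by rewrite v1 mulg1 alphax1 hat1 !horizx1; split.
  rewrite head_all // tail_all // eqxx; split.
    by case: eqP => // /mulg_eq1r.
  rewrite alphax1 iarr_inv hat1 !horizx1 -iarr_cat.
  by rewrite !(vert1x (arrow_vert (arrow_alpha Wuv) (arrow_iarr _))).
case=> Wx Wn.
have Wu := simple_ldvd Wuv; have Wv := simple_rdvd Wuv.
(* Here [x1] is what [u * v] absorbs from [x], [x2] is the part of the head after [v] that is left
   over by [u], and [x3] is the tail after [v]. *)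
rewrite /= head_mul // tail_split //; set x1 := head_of (u * v) x.
set h := head_of v x; set x3 := tail_of v x.
set x2 := tail_of u (v * h).
have hE : h = x1 * x2 by apply: head_split.
have xE : x = x1 * x2 * x3 by rewrite -hE; apply: head_tail.
have Wuvx : W (u * v * x1) by apply: simple_head.
have Wvxx : W (v * (x1 * x2)) by rewrite -hE; apply: simple_head.
have Wxxx : W (x1 * x2 * x3) by rewrite -xE.
have Wxx' := simple_rdvd (simple_mulA Wxxx).
have [IHa IHc] := IHn _ _ Wxx' Wn.
split; first by rewrite IHa mulgA.
have a := arrow_act_cell (simple_rdvd Wxxx) Wn.
have Wvxx' : W (v * x1 * x2) by rewrite -mulgA.
have Wuvx' := simple_mulA Wuvx.
(* The two slides delay [act_cell x3 n] until [u] has passed the first letter; it then meets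
   [act_cell x2], where the induction hypothesis applies. *)
have := congr1 (fun c => c ** I (wpath n)) (alpha_pentagon Wuvx Wvxx Wxxx).
have := congr1 (fun c => J (u * v * x1) ** c) IHc.
have := slide (arrow_alpha Wuvx') (arrow_horiz (arrow_iarr (hat x2)) a).
have := congr1 (fun c => J u ** c) (slide (arrow_beta Wvxx') a).
have hx3 : h * x3 = x by rewrite -head_tail.
have vhE : v * x1 * x2 = v * h by rewrite hE mulgA.
rewrite -hE hx3 vhE [u * (v * x1)]mulgA.
rewrite !(horiz_vertl, horiz_vertr, iarr_cat) -!horizA.
move=> e1 e2 e3 /(congr1 (fun c => c \; (J (u * v * x1) ** act_cell (x2 * x3) n))).
rewrite -!vertA => <-.
rewrite (vert_rewr _ (esym e1)) -!vertA (vert_rewr _ (esym e2)) -!vertA.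
by rewrite e3.
Qed.

(** * Normal forms of words and naturality of the normalising cells *)

Implicit Types (s t : seq (gar1 w0)) (a b : gar1 w0).

Lemma gar_word_cons a s : gar_word (a :: s) = hat (gval a) +++ gar_word s.
Proof. by rewrite hat_gval. Qed.

Lemma gar_word_cat s t : gar_word (s ++ t) = gar_word s +++ gar_word t :> path.
Proof. by elim: s => //= a s ->. Qed.

Lemma gar_wordK (p : path) : gar_word (path_seq p) = p.
Proof. by apply: path_seq_inj; elim: (path_seq p) => //= a s ->. Qed.

Fixpoint nf s : seq M := if s is a :: s' then act (gval a) (nf s') else [::].

Fixpoint nf_cell s : option (@arrow P tt) :=
  if s is a :: s' then
    (J (gval a) ** nf_cell s') \; act_cell (gval a) (nf s')
  else I (@path_id P tt).

Lemma nf_simple s : simples (nf s).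
Proof. by elim: s => //= -[a Wa ?] s IHs; apply: act_simple. Qed.

Lemma arrow_nf_cell s : arrow_of (nf_cell s) (gar_word s) (wpath (nf s)).
Proof.
elim: s => [|a s IHs]; first exact: arrow_iarr.
rewrite gar_word_cons; apply: arrow_vert.
  by apply: arrow_horiz IHs; apply: arrow_iarr.
by apply: arrow_act_cell (nf_simple s); case: a.
Qed.

(** The suffix [s] builds in stability under right whiskering. Prefixes can be added afterwards,
    because [nf] treats the rightmost letters first. *)
Definition natural (p q : path) (f : option (@arrow P tt)) : Prop :=
  forall s, nf (path_seq p ++ s) = nf (path_seq q ++ s) /\
  (f ** I (gar_word s)) \; nf_cell (path_seq q ++ s) = nf_cell (path_seq p ++ s).

(** This is [act_mul] at the word [nf s], after an interchange of [alpha] with [nf_cell s]. *)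
Lemma natural_gen (c : gar2 w0) :
  natural (@src2 P c) (@tgt2 P c) (gen_arrow c).
Proof.
case: c => a b abW s /=.
rewrite -alpha_gval; have [-> e] := act_mul abW (nf_simple s); split=> //.
rewrite horiz_vertr -vertA e [J _ ** J _ ** _]horizA -iarr_cat.
have := slide (arrow_alpha abW) (arrow_nf_cell s).
by rewrite !vertA => ->.
Qed.

Lemma natural_id p : natural p p (I p).
Proof.
move=> s; split=> //; rewrite -iarr_cat -{1}[p]gar_wordK -gar_word_cat.
by rewrite (vert1x (arrow_nf_cell _)).
Qed.

Lemma natural_vert p q r (f g : option (@arrow P tt)) :
  natural p q f -> natural q r g -> natural p r (f \; g).
Proof.
move=> pq qr s; have [pqn pqe] := pq s; have [qrn qre] := qr s.
by split; [rewrite pqn|rewrite horiz_vertl -vertA qre].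
Qed.

Lemma natural_inv p q (f : option (@arrow P tt)) :
  arrow_of f p q -> natural p q f -> natural q p (ivert f).
Proof.
move=> fpq pq s; have [pqn pqe] := pq s; split=> //.
rewrite -pqe vertA -horiz_vertl (vertVx fpq).
by have [_ ->] := natural_id q s.
Qed.

Lemma natural_horizl p q r (f : option (@arrow P tt)) : natural p q f ->
  natural (r +++ p) (r +++ q) (I r ** f).
Proof.
move=> pq s; rewrite -[in I r](gar_wordK r) !path_seq_cat -!catA -horizA.
elim: (path_seq r) => [|a l [IHn IHe]]; first by rewrite horiz1x; apply: pq.
rewrite [gar_word _]gar_word_cons iarr_cat /= IHn; split=> //.
by rewrite -horizA vertA -horiz_vertr IHe.
Qed.

Lemma natural_horiz p q p' q' (f g : option (@arrow P tt)) :
  arrow_of f p q -> arrow_of g p' q' ->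
  natural p q f -> natural p' q' g -> natural (p +++ p') (q +++ q') (f ** g).
Proof.
move=> fpq gpq pq pq'; rewrite (horizE fpq gpq).
apply: natural_vert (natural_horizl _ pq') => s.
rewrite !path_seq_cat -!catA -horizA -iarr_cat.
(* The right whiskering by [p'] is absorbed into the suffix. *)
have -> : p' +++ gar_word s = gar_word (path_seq p' ++ s).
  by rewrite gar_word_cat gar_wordK.
exact: pq.
Qed.

(** Terms are indexed by arbitrary 0-cells whereas [natural] is stated at [tt]; the [match] gives
    the induction a general enough motive. *)
Lemma natural_term (x y : cell0 P) (p q : @path1 P x y) (f : term2 p q) :
  match x, y return forall p q : @path1 P x y, term2 p q -> Prop with
  | tt, tt => fun p q c => natural p q (tcell c)
  end p q f.
Proof.
elim: x y p q / f.
- exact: natural_gen.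
- by move=> [] [] p; apply: natural_id.
- move=> [] [] p q r f IHf g IHg; rewrite -tcell_vert.
  exact: natural_vert IHf IHg.
- move=> [] [] p q f IHf; rewrite -tcell_inv.
  by apply: natural_inv IHf; apply: arrow_tcell.
- move=> [] [] [] p q p' q' f IHf g IHg; rewrite -tcell_horiz.
  by apply: natural_horiz => //; apply: arrow_tcell.
Qed.

(** By naturality with empty suffix, [f] and [g] followed by the normalising cell of [q] both give
    that of [p]; the normalising cell of [q] is invertible and cancels. *)
Lemma gar_homotopy_basis : homotopy_basis P.
Proof.
move=> [] [] p q f g; have [tf ->] := cell_term f; have [tg ->] := cell_term g.
apply/presented_term_eqP.
have [_] := natural_term tf [::]; have [_ <-] := natural_term tg [::].
rewrite !horizx1 !cats0 => e.
have ae := arrow_nf_cell (path_seq q); rewrite gar_wordK in ae.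
rewrite -(vertx1 (arrow_tcell tf)) -(vertx1 (arrow_tcell tg)) -(vertxV ae).
by rewrite !vertA e.
Qed.

(** * The monoid as the category presented by the 2-cells *)

Local Notation sim := (@congruence_closure (free_category P) (@gen2_rel P) tt tt).

Lemma sim_catl p q r : sim q r -> sim (p +++ q) (p +++ r).
Proof.
by move=> qr; apply: (cc_comp (C := free_category P)) qr; apply: cc_refl.
Qed.

Lemma sim_catr p q r : sim p q -> sim (p +++ r) (q +++ r).
Proof.
by move=> pq; apply: (cc_comp (C := free_category P)) pq _; apply: cc_refl.
Qed.

Lemma sim_hat u v : W (u * v) -> sim (hat u +++ hat v) (hat (u * v)).
Proof.
move=> Wuv; have [->|[a ea]] := simpleP (simple_ldvd Wuv).
  by rewrite hat1 mul1g; apply: cc_refl.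
have [->|[b eb]] := simpleP (simple_rdvd Wuv).
  by rewrite hat1 path_catp1 mulg1; apply: cc_refl.
subst u v; rewrite (hat_gval (gar_mul Mw0 Wuv)) !hat_gval.
by apply: cc_base; apply: (@Gen2Rel P (Gar2 Wuv)).
Qed.

Definition eval s : M := foldr (fun a m => gval a * m) 1 s.

Lemma eval_cat s t : eval (s ++ t) = eval s * eval t.
Proof. by elim: s => [|a s IHs] /=; rewrite ?mul1g // IHs mulgA. Qed.

(** The values of words form a submonoid containing [W], and [W] generates [M]. *)
Lemma eval_surj x : exists s, eval s = x.
Proof.
have : smallest (@submonoid M) W x by rewrite (garside_generates Mw0).
move=> /(_ [set y | exists s, eval s = y]%classic); apply; split.
  split; first by exists [::].
  by move=> f g [s <-] [t <-]; exists (s ++ t); rewrite eval_cat.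
move=> u /simpleP[->|[a ->]]; first by exists [::].
by exists [:: a]; rewrite /= mulg1.
Qed.

Lemma eval_sim (p q : path) : sim p q -> eval (path_seq p) = eval (path_seq q).
Proof.
suff key (x y : cell0 P) (p' q' : @path1 P x y) :
  @congruence_closure (free_category P) (@gen2_rel P) x y p' q' ->
  eval (path_seq p') = eval (path_seq q') by exact: key.
elim=> {x y p' q'} //=.
- by move=> x y _ _ [[a b abW]] /=; rewrite !mulg1.
- by move=> x y f g h _ -> _ ->.
- by move=> x y z f f' g g' _ ef _ eg; rewrite !path_seq_cat !eval_cat ef eg.
Qed.

Lemma hat_word u : W u -> exists2 s, gar_word s = hat u & eval s = u.
Proof.
move=> /simpleP[->|[a ->]]; first by exists [::]; rewrite ?hat1.
by exists [:: a]; rewrite ?hat_gval //= mulg1.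
Qed.

(* Induction on the length of the common value [x]: the first letters [a] and
   [b] of two words for [x] both divide their lcm [w], which is simple and
   divides [x], so both words are related to one starting with [w]. *)
Lemma eval_inj s t : eval s = eval t -> sim (gar_word s) (gar_word t).
Proof.
have [lambda [lambdaM lambda0]] := garside_length Mw0.
have [k] := ubnP (lambda (eval s)).
elim: k s t => // k IHk [|a s] [|b t] //=; first by move=> *; apply: cc_refl.
- by move=> _ /esym/(garside_mul_neq1 Mw0 (@gar1_neq1 _ _ b)).
- by move=> _ /(garside_mul_neq1 Mw0 (@gar1_neq1 _ _ a)).
rewrite ltnS => lt_k est.
have [w [[a' wa] [b' wb] minw]] := garside_llcm Mw0 (gval a) (gval b).
(* Both letters divide [w0], hence so does their lcm. *)
have Ww : W w by apply: minw; [case: (a)|case: (b)].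
have [x1 xE] : ldvd w (gval a * eval s).
  by apply: minw; [|rewrite est]; eexists.
have [r rE] := eval_surj x1.
have half c c' s' : w = gval c * c' -> gval c * eval s' = w * x1 ->
    sim (gar_word (c :: s')) (hat w +++ gar_word r).
  move=> wc cs; have Wc : W (gval c * c') by rewrite -wc.
  have [sc scw sce] := hat_word (simple_rdvd Wc).
  rewrite wc; apply: cc_trans (sim_catr _ (sim_hat Wc)).
  rewrite gar_word_cons -path_catA; apply: sim_catl.
  rewrite -scw -gar_word_cat; apply: IHk.
    (* The letter [c] is not [1], so its length is positive and removing it strictly decreases the
       length bound. *)
    have := lambdaM (gval c) (eval s'); rewrite cs -xE => le.
    have c0 := lambda0 _ (@gar1_neq1 _ _ c).
    apply: leq_trans lt_k; apply: leq_trans le.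
    by rewrite -[ltnLHS]add0n ltn_add2r lt0n; apply/eqP.
  by rewrite eval_cat sce rE; apply: (garside_lcancel Mw0 (f := gval c));
    rewrite cs wc mulgA.
apply: cc_trans (half a a' s wa xE) _; apply: cc_sym.
by apply: half wb _; rewrite -est.
Qed.

Definition eval_class (x y : cell0 P) (c : hom (presented_category P) x y) : M :=
  eval (path_seq (rep c)).

Lemma eval_class_cls (p : path) :
  @eval_class tt tt (@quotient_cls (free_category P) (@gen2_rel P) tt tt p) =
  eval (path_seq p).
Proof. by apply: eval_sim; apply: rep_cls. Qed.

Lemma eval_class_id (x : cell0 P) :
  eval_class (idc (presented_category P) x) = 1.
Proof. by case: x; apply: eval_class_cls. Qed.

Lemma eval_class_comp (x y z : cell0 P) (c : hom (presented_category P) x y)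
    (d : hom (presented_category P) y z) :
  eval_class (Defs.comp c d) = eval_class c * eval_class d.
Proof.
case: x y z c d => -[] [] c d.
by rewrite [LHS]eval_class_cls path_seq_cat eval_cat.
Qed.

Lemma gar_presents :
  isomorphic_categories (presented_category P) (monoid_category M).
Proof.
exists (@Functor (presented_category P) (monoid_category M) (fun _ => tt)
  eval_class eval_class_id eval_class_comp); split.
  by exists (fun _ => tt) => -[].
(* The inverse on morphisms sends [x] to the class of a chosen word with value [x]; by [eval_inj]
   the class does not depend on the choice. *)
move=> [] [] /=; have [g gP] := choice eval_surj.
exists (fun x => @quotient_cls (free_category P) (@gen2_rel P) tt tt
  (gar_word (g x))) => [c|x].
  rewrite -[RHS]quotient_repK; apply/clsP.
  rewrite -[X in sim _ X]gar_wordK; apply: eval_inj; exact: gP.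
rewrite eval_class_cls -[RHS]gP; congr eval.
by elim: (g x) => //= a s ->.
Qed.

End Garside.

Theorem theorem3p3p3 (M : monoidType) (w0 : M) (Mw0 : garside w0) :
  coherent_presentation (Gar_3 Mw0) (monoid_category M).
Proof. by split; [apply: gar_presents|apply: gar_homotopy_basis]. Qed.
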